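(* Let $\mathcal{G}$ be a groupoid, let $\mathcal{R}$ be a unital ring bundle over $\mathcal{G}^{(0)}$, and let $M\in C^1(\mathcal{G},\operatorname{Iso}(\mathcal{R}))$ be outer with $\operatorname{Ext}(\mathcal{G},\mathcal{R})_{[M]}\neq\emptyset$. Then the following assertions hold: (a) Each class in $\operatorname{Ext}(\mathcal{G},\mathcal{R})_{[M]}$ can be represented by one of the form $\mathcal{R}\times_{(M,\tau)}\mathcal{G}$. (b) Let $(M,\tau')$ and $(M,\tau)$ be factor systems for $(\mathcal{G},\mathcal{R})$. Then $\tau^{-1}\cdot\tau'\in Z^2(\mathcal{G},Z(\mathcal{R})^\times)_M$, and moreover $(M,\tau')\sim(M,\tau)$ if and only if $\tau^{-1}\cdot\tau'\in B^2(\mathcal{G},Z(\mathcal{R})^\times)_M$.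
   Context: Groupoids are purely algebraic. A groupoid $\mathcal{G}$ has unit space $\mathcal{G}^{(0)}\subseteq\mathcal{G}$ and range and source maps $r,s$; $xy$ is defined iff $s(x)=r(y)$; $\mathcal{G}^{(n)}$ is the set of $n$-tuples with $s(x_i)=r(x_{i+1})$. Rings are associative. A unital ring bundle $\mathcal{R}$ over $\mathcal{G}^{(0)}$ is a set with a map to $\mathcal{G}^{(0)}$ whose fibres $R_u$ are unital rings; $\mathcal{R}^\times:=\bigcup_uR_u^\times$ and $R:=\bigoplus_{u\in\mathcal{G}^{(0)}}R_u$. Factor systems. $C^1(\mathcal{G},\operatorname{Iso}(\mathcal{R}))$ is the set of families of ring isomorphisms $M_x:R_{s(x)}\to R_{r(x)}$, $x\in\mathcal{G}$, with $M_u=\mathrm{id}_{R_u}$ for $u\in\mathcal{G}^{(0)}$. $C^2(\mathcal{G},\mathcal{R}^\times)$ is the set of maps $\tau:\mathcal{G}^{(2)}\to\mathcal{R}^\times$ with $\tau(x,y)\in R_{r(x)}^\times$ and $\tau(x,s(x))=\tau(r(x),x)=1_{R_{r(x)}}$. A factor system for $(\mathcal{G},\mathcal{R})$ is a pair $(M,\tau)$ satisfying the twisted action condition $M_xM_y(n)=\tau(x,y)M_{xy}(n)\tau(x,y)^{-1}$ ($(x,y)\in\mathcal{G}^{(2)}$, $n\in R_{s(y)}$) and $\tau(x,y)\tau(xy,z)=M_x(\tau(y,z))\tau(x,yz)$ ($(x,y,z)\in\mathcal{G}^{(3)}$). $C^1(\mathcal{G},\mathcal{R}^\times)$ is the group of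 maps $h:\mathcal{G}\to\mathcal{R}^\times$ with $h(x)\in R_{r(x)}^\times$ and $h(u)=1_{R_u}$ for $u\in\mathcal{G}^{(0)}$; it acts on factor systems by $h.(M,\tau)=(h.M,h.\tau)$, $(h.M)_x(n)=h(x)M_x(n)h(x)^{-1}$, $(h.\tau)(x,y)=h(x)M_x(h(y))\tau(x,y)h(xy)^{-1}$. Write $(M,\tau)\sim(M',\tau')$ if they lie in the same orbit. $M$ is outer if some $\tau\in C^2(\mathcal{G},\mathcal{R}^\times)$ makes $(M,\tau)$ satisfy the twisted action condition; on outer elements $M\sim M'$ iff $M'=h.M$ for some $h\in C^1(\mathcal{G},\mathcal{R}^\times)$, with classes $[M]$. Crossed products. A ring $S$ is $\mathcal{G}$-graded if $S=\bigoplus_{x\in\mathcal{G}}S_x$ with additive subgroups $S_x$, $S_xS_y\subseteq S_{xy}$ if $(x,y)\in\mathcal{G}^{(2)}$ and $S_xS_y=\{0\}$ otherwise. It is object unital if each $S_u$, $u\in\mathcal{G}^{(0)}$, is unital and $1_{S_{r(x)}}a=a=a1_{S_{s(x)}}$ for all $a\in S_x$. An object unital $\mathcal{G}$-graded ring $S$ is a $\mathcal{G}$-crossed product if for every $x$ there are $a\in S_x$, $b\in S_{x^{-1}}$ with $ba=1_{S_{s(x)}}$, $ab=1_{S_{r(x)}}$; it is a $\mathcal{G}$-crossed product over $R$ if $\bigoplus_{u\in\mathcal{G}^{(0)}}S_u=R$ (with $S_u=R_u$). Two of these are equivalent if there is a graded ring isomorphism between them restricting to $\mathrm{id}_R$;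 $\operatorname{Ext}(\mathcal{G},\mathcal{R})$ is the set of equivalence classes. For a factor system, $\mathcal{R}\times_{(M,\tau)}\mathcal{G}$ is the ring of finitely supported $f:\mathcal{G}\to\mathcal{R}$ with $f(x)\in R_{r(x)}$, pointwise sum and product $(fg)(z)=\sum_{xy=z}f(x)M_x(g(y))\tau(x,y)$; it is a $\mathcal{G}$-crossed product over $R$, and every $\mathcal{G}$-crossed product over $R$ can be presented in this way. $\operatorname{Ext}(\mathcal{G},\mathcal{R})_{[M]}$ is the set of classes corresponding to $[M]$, i.e. containing some $\mathcal{R}\times_{(M',\tau')}\mathcal{G}$ with $M'\sim M$. Cohomology. $Z(\mathcal{R})^\times:=\bigcup_uZ(R_u)^\times$, on which the $M_x$ of an outer $M$ satisfy $M_xM_y=M_{xy}$. An $n$-cochain ($n\ge1$) is a map $h:\mathcal{G}^{(n)}\to Z(\mathcal{R})^\times$ with $h(x_1,\dots,x_n)\in Z(R_{r(x_1)})^\times$ taking identity values whenever some $x_i$ is a unit. $d^1_M(h)(x,y)=M_x(h(y))h(xy)^{-1}h(x)$, $d^2_M(\rho)(x,y,z)=M_x(\rho(y,z))\rho(xy,z)^{-1}\rho(x,yz)\rho(x,y)^{-1}$, $Z^2(\mathcal{G},Z(\mathcal{R})^\times)_M=\ker d^2_M$, $B^2(\mathcal{G},Z(\mathcal{R})^\times)_M=\operatorname{im}d^1_M$. Products and inverses of maps such as $\tau^{-1}\cdot\tau'$ are pointwise. *)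

(* Defs.v *)
From HB Require Import structures.
From mathcomp Require Import all_boot all_algebra finmap.
From mathcomp Require Import boolp classical_sets functions cardinality fsbigop.

Set Implicit Arguments.
Unset Strict Implicit.
Unset Printing Implicit Defensive.
Import GRing.Theory.
Local Open Scope classical_set_scope.
Local Open Scope ring_scope.

(* [hom u v] is the set of groupoid elements x with r(x) = u and s(x) = v, so
   that [gcomp x y] is the product xy, typeable exactly when s(x) = r(y).  The
   unit space is identified with the type of objects along u |-> gid u. *)
Record groupoid := Groupoid {
  obj :> Type;
  hom : obj -> obj -> Type;
  gid : forall u, hom u u;
  gcomp : forall u v w, hom u v -> hom v w -> hom u w;
  ginv : forall u v, hom u v -> hom v u;
  gcompA : forall t u v w (x : hom t u) (y : hom u v) (z : hom v w),
    gcomp x (gcomp y z) = gcomp (gcomp x y) z;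
  gcomp1l : forall u v (x : hom u v), gcomp (gid u) x = x;
  gcomp1r : forall u v (x : hom u v), gcomp x (gid v) = x;
  gcompVl : forall u v (x : hom u v), gcomp (ginv x) x = gid v;
  gcompVr : forall u v (x : hom u v), gcomp x (ginv x) = gid u
}.
Arguments hom {g} u v.
Arguments gid {g} u.
Arguments gcomp {g u v w} x y.
Arguments ginv {g u v} x.

(* The groupoid as a single set. *)
Record arr (G : groupoid) := Arr { arr_r : G; arr_s : G; arr_hom : hom arr_r arr_s }.
Arguments Arr {G arr_r arr_s} arr_hom.
HB.instance Definition _ (G : groupoid) := gen_eqMixin (arr G).
HB.instance Definition _ (G : groupoid) := gen_choiceMixin (arr G).

(* [pzRingType]: fibres are unital, and the zero ring is allowed. *)
Definition ringBundle (G : groupoid) := G -> pzRingType.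

Record units (R : pzRingType) := Units {
  uval : R;
  uinv : R;
  uvalV : uval * uinv = 1;
  uVval : uinv * uval = 1
}.

Lemma units_inj (R : pzRingType) : injective (@uval R).
Proof.
move=> [a b ab ba] [a' b' ab' ba'] /= e; subst a'.
have e : b = b' by rewrite -[b]mulr1 -ab' mulrA ba mul1r.
subst b'; congr Units; exact: Prop_irrelevance.
Qed.

HB.instance Definition _ (R : pzRingType) := gen_eqMixin (units R).
HB.instance Definition _ (R : pzRingType) := gen_choiceMixin (units R).

Section UnitGroup.
Variable R : pzRingType.
Implicit Types a b : units R.

Definition units1 : units R := Units (mulr1 1) (mulr1 1).

Fact units_mul_subproof a b :
  (uval a * uval b) * (uinv b * uinv a) = 1 /\
  (uinv b * uinv a) * (uval a * uval b) = 1.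
Proof.
split; first by rewrite mulrA -(mulrA (uval a)) uvalV mulr1 uvalV.
by rewrite mulrA -(mulrA (uinv b)) uVval mulr1 uVval.
Qed.

Definition units_mul a b : units R :=
  Units (units_mul_subproof a b).1 (units_mul_subproof a b).2.

Definition units_inv a : units R := Units (uVval a) (uvalV a).

Fact units_mulA : associative units_mul.
Proof. by move=> a b c; apply: units_inj; rewrite /= mulrA. Qed.
Fact units_mul1 : left_id units1 units_mul.
Proof. by move=> a; apply: units_inj; rewrite /= mul1r. Qed.
Fact units_mulr1 : right_id units1 units_mul.
Proof. by move=> a; apply: units_inj; rewrite /= mulr1. Qed.
Fact units_mulV : left_inverse units1 units_inv units_mul.
Proof. by move=> a; apply: units_inj; rewrite /= uVval. Qed.
Fact units_mulrV : right_inverse units1 units_inv units_mul.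
Proof. by move=> a; apply: units_inj; rewrite /= uvalV. Qed.

HB.instance Definition _ := isGroup.Build (units R)
  units_mulA units_mul1 units_mulr1 units_mulV units_mulrV.
End UnitGroup.

Section UnitMap.
Variables (R S : pzRingType) (f : {rmorphism R -> S}).

Fact umap_subproof (a : units R) :
  f (uval a) * f (uinv a) = 1 /\ f (uinv a) * f (uval a) = 1.
Proof. by rewrite -!rmorphM uvalV uVval rmorph1. Qed.

Definition umap (a : units R) : units S :=
  Units (umap_subproof a).1 (umap_subproof a).2.
End UnitMap.

Section Conjugation.
Variables (R S : pzRingType) (c : units S) (f : {rmorphism R -> S}).

Definition conj_mor (n : R) : S := uval c * f n * uval (c^-1)%g.

Fact conj_mor_zmod : zmod_morphism conj_mor.
Proof. by move=> a b; rewrite /conj_mor rmorphB mulrBr mulrBl. Qed.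
Fact conj_mor_monoid : monoid_morphism conj_mor.
Proof.
split; first by rewrite /conj_mor rmorph1 mulr1 /= uvalV.
move=> a b; rewrite /conj_mor rmorphM /= !mulrA; congr (_ * _).
by rewrite -(mulrA _ (uinv c)) uVval mulr1.
Qed.

HB.instance Definition _ := GRing.isZmodMorphism.Build R S conj_mor conj_mor_zmod.
HB.instance Definition _ :=
  GRing.isMonoidMorphism.Build R S conj_mor conj_mor_monoid.
End Conjugation.

Definition central (R : pzRingType) : set R := [set a | forall b, a * b = b * a].

(* Z(R)^*: units of R lying in the centre together with their inverse. *)
Definition central_unit (R : pzRingType) : set (units R) :=
  [set a | central (uval a) /\ central (uval (a^-1)%g)].

Section FactorSystems.
Variables (G : groupoid) (R : ringBundle G).

Definition morFamily := forall u v : G, hom u v -> {rmorphism R v -> R u}.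
Definition cochain1 := forall u v : G, hom u v -> units (R u).
Definition cochain2 := forall u v w : G, hom u v -> hom v w -> units (R u).

Definition C1_Iso : set morFamily := [set M : morFamily |
  (forall u v (x : hom u v), bijective (M u v x)) /\
  (forall u (n : R u), M u u (gid u) n = n)].

Definition C1 : set cochain1 := [set h : cochain1 |
  forall u, h u u (gid u) = 1%g].

Definition C2 : set cochain2 := [set tau : cochain2 |
  forall u v (x : hom u v),
    tau u v v x (gid v) = 1%g /\ tau u u v (gid u) x = 1%g].

Definition twisted_action (M : morFamily) (tau : cochain2) :=
  forall u v w (x : hom u v) (y : hom v w) (n : R w),
    M _ _ x (M _ _ y n)
    = uval (tau _ _ _ x y) * M _ _ (gcomp x y) n * uval ((tau _ _ _ x y)^-1)%g.

Definition twisted_cocycle (M : morFamily) (tau : cochain2) :=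
  forall t u v w (x : hom t u) (y : hom u v) (z : hom v w),
    (tau _ _ _ x y * tau _ _ _ (gcomp x y) z
     = umap (M _ _ x) (tau _ _ _ y z) * tau _ _ _ x (gcomp y z))%g.

Definition is_factor_system (M : morFamily) (tau : cochain2) :=
  [/\ C1_Iso M, C2 tau, twisted_action M tau & twisted_cocycle M tau].

Record factorSystem := FactorSystem {
  fs_mor : morFamily;
  fs_tau : cochain2;
  fsP : is_factor_system fs_mor fs_tau
}.

Definition act_mor (h : cochain1) (M : morFamily) : morFamily :=
  fun u v x => conj_mor (h u v x) (M u v x).

Definition act_cochain2 (h : cochain1) (M : morFamily) (tau : cochain2) :
    cochain2 :=
  fun u v w x y =>
    (h u v x * umap (M u v x) (h v w y) * tau u v w x y
     * (h u w (gcomp x y))^-1)%g.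

Definition eq_mor (M M' : morFamily) :=
  forall u v (x : hom u v), M u v x =1 M' u v x.

Definition fs_sim (F F' : factorSystem) :=
  exists h : cochain1, [/\ C1 h, eq_mor (fs_mor F') (act_mor h (fs_mor F))
    & fs_tau F' = act_cochain2 h (fs_mor F) (fs_tau F)].

Definition outer (M : morFamily) :=
  C1_Iso M /\ exists tau, C2 tau /\ twisted_action M tau.

Definition mor_sim (M M' : morFamily) :=
  exists h : cochain1, C1 h /\ eq_mor M' (act_mor h M).

(* Cochains with values in Z(R)^*. *)
Definition CZ1 : set cochain1 := [set h : cochain1 |
  C1 h /\ forall u v (x : hom u v), central_unit (h u v x)].

Definition CZ2 : set cochain2 := [set rho : cochain2 |
  C2 rho /\
  forall u v w (x : hom u v) (y : hom v w), central_unit (rho u v w x y)].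

Definition d1 (M : morFamily) (h : cochain1) : cochain2 := fun u v w x y =>
  (umap (M u v x) (h v w y) * (h u w (gcomp x y))^-1 * h u v x)%g.

Definition d2 (M : morFamily) (rho : cochain2)
    t u v w (x : hom t u) (y : hom u v) (z : hom v w) : units (R t) :=
  (umap (M t u x) (rho u v w y z) * (rho t v w (gcomp x y) z)^-1
   * rho t u w x (gcomp y z) * (rho t u v x y)^-1)%g.

Definition Z2 (M : morFamily) : set cochain2 := [set rho : cochain2 |
  CZ2 rho /\
  forall t u v w (x : hom t u) (y : hom u v) (z : hom v w), d2 M rho x y z = 1%g].

Definition B2 (M : morFamily) : set cochain2 := d1 M @` CZ1.

Definition cochain2_inv (tau : cochain2) : cochain2 :=
  fun u v w x y => ((tau u v w x y)^-1)%g.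
Definition cochain2_mul (tau tau' : cochain2) : cochain2 :=
  fun u v w x y => (tau u v w x y * tau' u v w x y)%g.

End FactorSystems.

(* Associative rings, not necessarily unital. *)
Record assocRing := AssocRing {
  ar_car :> zmodType;
  ar_mul : ar_car -> ar_car -> ar_car;
  ar_mulA : associative ar_mul;
  ar_mulDl : left_distributive ar_mul +%R;
  ar_mulDr : right_distributive ar_mul +%R
}.

Record gradedRing (G : groupoid) := GradedRing {
  gr_ring :> assocRing;
  gr_comp : arr G -> set gr_ring;
  gr_comp0 : forall x, gr_comp x 0;
  gr_compB : forall x a b, gr_comp x a -> gr_comp x b -> gr_comp x (a - b);
  gr_direct : forall a : gr_ring, exists! c : arr G -> gr_ring,
    [/\ forall x, gr_comp x (c x), finite_set [set x | c x <> 0]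
      & a = \sum_(x \in [set: arr G]) c x];
  gr_mul_comp : forall (u v w : G) (x : hom u v) (y : hom v w) a b,
    gr_comp (Arr x) a -> gr_comp (Arr y) b ->
    gr_comp (Arr (gcomp x y)) (ar_mul a b);
  gr_mul_zero : forall (x y : arr G) a b, arr_s x <> arr_r y ->
    gr_comp x a -> gr_comp y b -> ar_mul a b = 0
}.

(* [one u] is the unit of S_u: that it is neutral in S_u is the second clause
   at x = gid u. *)
Definition object_unital (G : groupoid) (S : gradedRing G) (one : G -> S) :=
  (forall u, gr_comp (Arr (gid u)) (one u)) /\
  (forall (x : arr G) (a : S), gr_comp x a ->
     ar_mul (one (arr_r x)) a = a /\ ar_mul a (one (arr_s x)) = a).

(* The equality of R and the direct sum of the S_u is recorded by ring
   isomorphisms [cp_emb u] of R_u onto S_u. *)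
Record crossedProduct (G : groupoid) (R : ringBundle G) := CrossedProduct {
  cp_ring :> gradedRing G;
  cp_one : G -> cp_ring;
  cp_unital : object_unital cp_one;
  cp_inv : forall u v (x : hom u v), exists a b : cp_ring,
    [/\ gr_comp (Arr x) a, gr_comp (Arr (ginv x)) b,
        ar_mul b a = cp_one v & ar_mul a b = cp_one u];
  cp_emb : forall u, R u -> cp_ring;
  cp_embD : forall u, {morph @cp_emb u : a b / a + b};
  cp_embM : forall u, {morph @cp_emb u : a b / a * b >-> ar_mul a b};
  cp_emb_inj : forall u, injective (@cp_emb u);
  cp_emb_range : forall u, range (@cp_emb u) = gr_comp (Arr (gid u))
}.

(* The last clause is the requirement that f restricts to the identity of R. *)
Definition cp_equiv (G : groupoid) (R : ringBundle G)
    (S T : crossedProduct R) :=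
  exists f : S -> T,
    [/\ bijective f,
        {morph f : a b / a + b} /\ {morph f : a b / ar_mul a b >-> ar_mul a b},
        forall x : arr G, f @` gr_comp x = gr_comp x
      & forall u (a : R u), f (cp_emb S a) = cp_emb T a].

(* Classes are predicates because [set] is not available at the universe of
   [crossedProduct R]. *)
Definition Ext (G : groupoid) (R : ringBundle G)
    (C : crossedProduct R -> Prop) : Prop :=
  exists S, C = cp_equiv S.

Lemma arr_inj (G : groupoid) (u v : G) (x y : hom u v) : Arr x = Arr y -> x = y.
Proof.
move=> e; pose P (a : arr G) := forall (er : arr_r a = u) (es : arr_s a = v),
  ecast r (hom r v) er (ecast s (hom _ s) es (arr_hom a)) = y.
have Py : P (Arr y).
  by move=> er es; rewrite (Prop_irrelevance er erefl) (Prop_irrelevance es erefl).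
by move: Py; rewrite -e => /(_ erefl erefl).
Qed.

Lemma arr_gcomp (G : groupoid) (u v w u' v' w' : G) (x : hom u v) (y : hom v w)
    (x' : hom u' v') (y' : hom v' w') :
  Arr x = Arr x' -> Arr y = Arr y' -> Arr (gcomp x y) = Arr (gcomp x' y').
Proof.
move=> ex ey.
have eu : u = u' := congr1 (@arr_r G) ex.
have ev : v = v' := congr1 (@arr_s G) ex.
have ew : w = w' := congr1 (@arr_s G) ey.
by subst u' v' w'; rewrite (arr_inj ex) (arr_inj ey).
Qed.

Lemma fsum_split (T : choiceType) (V : zmodType) (P : set T) (f g : T -> V) :
  finite_set [set x | f x <> 0] -> finite_set [set x | g x <> 0] ->
  \sum_(x \in P) (f x + g x) = \sum_(x \in P) f x + \sum_(x \in P) g x.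
Proof.
move=> ff gf.
set A := [set x | f x <> 0] `|` [set x | g x <> 0].
have Af : finite_set (P `&` A) by apply: finite_setIr; rewrite finite_setU.
have PA : P `&` A `<=` P by move=> x [].
have f0 x : (P `\` (P `&` A)) x -> f x = 0.
  by move=> [Px nA]; apply: contrapT => fx; apply: nA; split=> //; left.
have g0 x : (P `\` (P `&` A)) x -> g x = 0.
  by move=> [Px nA]; apply: contrapT => gx; apply: nA; split=> //; right.
rewrite -(fsbig_widen (P `&` A) P (fun x => f x + g x)) //; last first.
  by move=> x nA; rewrite /preimage /= f0 ?g0 ?addr0.
rewrite -(fsbig_widen (P `&` A) P f) // -(fsbig_widen (P `&` A) P g) //.
exact: fsbig_split.
Qed.

Section CrossedProductOfFactorSystem.
Variables (G : groupoid) (R : ringBundle G).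

Record finSection := FinSection {
  sec_fun :> forall x : arr G, R (arr_r x);
  sec_fin : finite_set [set x | sec_fun x <> 0]
}.

HB.instance Definition _ := gen_eqMixin finSection.
HB.instance Definition _ := gen_choiceMixin finSection.

Lemma finSectionP (f g : finSection) : (forall x, f x = g x) -> f = g.
Proof.
case: f g => f ff [g gf] /= fg.
have e : f = g by apply: functional_extensionality_dep.
subst g; congr FinSection; exact: Prop_irrelevance.
Qed.

Fact sec0_fin : finite_set [set x : arr G | (0 : R (arr_r x)) <> 0].
Proof. by apply: (sub_finite_set _ (finite_set0 _)) => x /= /(_ erefl). Qed.
Definition sec0 := FinSection sec0_fin.

Fact secN_fin (f : finSection) : finite_set [set x | - f x <> 0].
Proof.
by apply: (sub_finite_set _ (sec_fin f)) => x /= + e; apply; rewrite e oppr0.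
Qed.
Definition secN f := FinSection (secN_fin f).

Fact secD_fin (f g : finSection) : finite_set [set x | f x + g x <> 0].
Proof.
have fg : finite_set ([set x | f x <> 0] `|` [set x | g x <> 0]).
  by rewrite finite_setU; split; exact: sec_fin.
apply: (sub_finite_set _ fg) => x /= n0.
have [f0|f0] := pselect (f x = 0); last by left.
by right=> g0; apply: n0; rewrite f0 g0 addr0.
Qed.
Definition secD f g := FinSection (secD_fin f g).

Fact secDA : associative secD.
Proof. by move=> f g h; apply: finSectionP => x /=; rewrite addrA. Qed.
Fact secDC : commutative secD.
Proof. by move=> f g; apply: finSectionP => x /=; rewrite addrC. Qed.
Fact sec0D : left_id sec0 secD.
Proof. by move=> f; apply: finSectionP => x /=; rewrite add0r. Qed.
Fact secND : left_inverse sec0 secN secD.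
Proof. by move=> f; apply: finSectionP => x /=; rewrite addNr. Qed.

HB.instance Definition _ :=
  GRing.isZmodule.Build finSection secDA secDC sec0D secND.

Lemma sec0E x : (0 : finSection) x = 0. Proof. by []. Qed.
Lemma secDE (f g : finSection) x : (f + g) x = f x + g x. Proof. by []. Qed.
Lemma secBE (f g : finSection) x : (f - g) x = f x - g x. Proof. by []. Qed.

(* Pairs (x, y) of composable arrows with r(x) = u and s(y) = w. *)
Record factorization (u w : G) := Factorization {
  fmid : G; flft : hom u fmid; frgt : hom fmid w
}.
HB.instance Definition _ u w := gen_eqMixin (factorization u w).
HB.instance Definition _ u w := gen_choiceMixin (factorization u w).

Variable F : factorSystem R.

Definition cp_term (f g : finSection) (u w : G) (p : factorization u w) : R u :=
  f (Arr (flft p)) * fs_mor F (flft p) (g (Arr (frgt p)))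
  * uval (fs_tau F (flft p) (frgt p)).

(* (fg)(z) is the sum of f(x) M_x(g(y)) tau(x,y) over xy = z; only finitely
   many terms are nonzero (cp_term_fin). *)
Definition cp_mul_fun (f g : finSection) (z : arr G) : R (arr_r z) :=
  \sum_(p \in [set p : factorization (arr_r z) (arr_s z) |
                 gcomp (flft p) (frgt p) = arr_hom z]) cp_term f g p.


Lemma factorization_inj (u w : G) (p q : factorization u w) :
  Arr (flft p) = Arr (flft q) -> Arr (frgt p) = Arr (frgt q) -> p = q.
Proof.
case: p q => [m x y] [m' x' y'] /= ex ey.
have em : m = m' := congr1 (@arr_s G) ex.
by subst m'; rewrite (arr_inj ex) (arr_inj ey).
Qed.

Lemma cp_term_neq0 (f g : finSection) u w (p : factorization u w) :
  cp_term f g p <> 0 -> f (Arr (flft p)) <> 0 /\ g (Arr (frgt p)) <> 0.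
Proof.
rewrite /cp_term => n0; split=> e; apply: n0; rewrite e.
  by rewrite !mul0r.
by rewrite rmorph0 mulr0 mul0r.
Qed.

Lemma cp_term_fin (f g : finSection) u w :
  finite_set [set p : factorization u w | cp_term f g p <> 0].
Proof.
pose D : set (arr G * arr G) := [set x | f x <> 0] `*` [set x | g x <> 0].
have Df : finite_set D by apply: finite_setX; exact: sec_fin.
pose k (p : factorization u w) := (Arr (flft p), Arr (frgt p)).
apply: (@sub_finite_set _ _ (k @^-1` D)) => [p /cp_term_neq0 //|].
apply: finite_preimage => // p q _ _ e.
by apply: factorization_inj; [exact: (congr1 fst e) | exact: (congr1 snd e)].
Qed.

Definition sec_single (x : arr G) (a : R (arr_r x)) (y : arr G) : R (arr_r y) :=
  if pselect (x = y) is left e then ecast z (R (arr_r z)) e a else 0.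

Lemma sec_singleE x (a : R (arr_r x)) : sec_single a x = a.
Proof.
rewrite /sec_single; case: pselect => // e.
by rewrite (Prop_irrelevance e erefl).
Qed.

Lemma sec_single_neq x (a : R (arr_r x)) y : x <> y -> sec_single a y = 0.
Proof. by rewrite /sec_single; case: pselect. Qed.

Fact sec_single_fin x (a : R (arr_r x)) :
  finite_set [set y | sec_single a y <> 0].
Proof.
apply: (@sub_finite_set _ _ [set x]) => [y /= n0|]; last exact: finite_set1.
by apply: contrapT => yx; apply: n0; apply: sec_single_neq => e; apply: yx.
Qed.

Definition single x (a : R (arr_r x)) := FinSection (sec_single_fin a).

Lemma singleE x (a : R (arr_r x)) : single a x = a.
Proof. exact: sec_singleE. Qed.

Lemma single_neq x (a : R (arr_r x)) y : x <> y -> single a y = 0.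
Proof. exact: sec_single_neq. Qed.

Lemma single_at x (f : finSection) :
  (forall y, y <> x -> f y = 0) -> f = single (f x).
Proof.
move=> f0; apply: finSectionP => y; have [<-|xy] := pselect (x = y).
  by rewrite singleE.
by rewrite single_neq // f0 // => e; apply: xy.
Qed.

Lemma single0 x : single (0 : R (arr_r x)) = 0.
Proof. by rewrite [RHS](@single_at x). Qed.

Lemma singleD x (a b : R (arr_r x)) : single (a + b) = single a + single b.
Proof.
rewrite [RHS](@single_at x); last first.
  by move=> y yx; rewrite secDE !single_neq ?addr0 // => e; apply: yx.
by rewrite secDE !singleE.
Qed.

Lemma finSection_ind (P : finSection -> Prop) :
  P 0 -> (forall x (a : R (arr_r x)) f, P f -> P (single a + f)) ->
  forall f, P f.
Proof.
move=> P0 Ps f; have /finite_seqP [s Es] := sec_fin f.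
have : forall x, f x <> 0 -> x \in s.
  by move=> x fx; have : [set` s] x by rewrite -Es.
elim: s f {Es} => [|x s IH] f fs.
  suff -> : f = 0 by [].
  by apply: finSectionP => x; apply: contrapT => /fs.
rewrite -(subrK (single (f x)) f) addrC; apply: Ps; apply: IH => y.
rewrite secBE; have [<-|xy] := pselect (x = y).
  by rewrite singleE subrr.
rewrite single_neq // subr0 => /fs; rewrite inE => /orP[/eqP e|//].
by case: xy.
Qed.

Fact cp_mul_fin (f g : finSection) : finite_set [set z | cp_mul_fun f g z <> 0].
Proof.
pose D : set (arr G * arr G) := [set x | f x <> 0] `*` [set x | g x <> 0].
have Df : finite_set D by apply: finite_setX; exact: sec_fin.
pose k (p : arr G * arr G) : arr G :=
  if pselect (arr_s p.1 = arr_r p.2) is left e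
  then Arr (gcomp (ecast s (hom _ s) e (arr_hom p.1)) (arr_hom p.2)) else p.1.
apply: (sub_finite_set _ (finite_image k Df)) => -[u w z] /= n0.
apply: contrapT => nD; apply: n0; apply: fsbig1 => p /= pz.
apply: contrapT => /cp_term_neq0 [fp gp]; apply: nD.
exists (Arr (flft p), Arr (frgt p)) => //.
rewrite /k /=; case: pselect => // e.
by rewrite (Prop_irrelevance e erefl) /= pz.
Qed.

Definition cp_mul (f g : finSection) := FinSection (cp_mul_fin f g).

Fact cp_mulDl : left_distributive cp_mul +%R.
Proof.
move=> f f' g; apply: finSectionP => z; rewrite secDE /= /cp_mul_fun.
rewrite -fsum_split; try exact: cp_term_fin.
by apply: eq_fsbigr => p _; rewrite /cp_term secDE !mulrDl.
Qed.

Fact cp_mulDr : right_distributive cp_mul +%R.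
Proof.
move=> f g g'; apply: finSectionP => z; rewrite secDE /= /cp_mul_fun.
rewrite -fsum_split; try exact: cp_term_fin.
by apply: eq_fsbigr => p _; rewrite /cp_term secDE rmorphD mulrDr mulrDl.
Qed.

Lemma cp_mul0l f : cp_mul 0 f = 0.
Proof. by apply: (addrI (cp_mul 0 f)); rewrite -cp_mulDl !addr0. Qed.
Lemma cp_mul0r f : cp_mul f 0 = 0.
Proof. by apply: (addrI (cp_mul f 0)); rewrite -cp_mulDr !addr0. Qed.

Lemma cp_mul_single u v w (x : hom u v) (y : hom v w) (a : R u) (b : R v) :
  cp_mul (single (a : R (arr_r (Arr x)))) (single (b : R (arr_r (Arr y)))) =
  single (a * fs_mor F x b * uval (fs_tau F x y) : R (arr_r (Arr (gcomp x y)))).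
Proof.
apply: finSectionP => z; rewrite [LHS]/= /cp_mul_fun.
have supp (p : factorization (arr_r z) (arr_s z)) :
    cp_term (single (a : R (arr_r (Arr x)))) (single (b : R (arr_r (Arr y)))) p
      <> 0 -> Arr (flft p) = Arr x /\ Arr (frgt p) = Arr y.
  move=> /cp_term_neq0 [n1 n2].
  by split; apply: contrapT => n; [apply: n1 | apply: n2];
     apply: single_neq => e; apply: n.
have [ez|nz] := pselect (Arr (gcomp x y) = z); last first.
  rewrite single_neq //; apply: fsbig1 => p /= pz; apply: contrapT => n0.
  apply: nz; have [ex ey] := supp p n0.
  rewrite -(arr_gcomp ex ey) pz; by case: (z).
subst z; rewrite singleE -(fsbig_widen [set Factorization x y]).
- by rewrite fsbig_set1 /cp_term /= !sec_singleE.
- by move=> p ->.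
- move=> p /= [_ np]; apply: contrapT => n0; apply: np.
  by have [ex ey] := supp p n0; apply: factorization_inj.
Qed.

Lemma cp_mul_single0 (x y : arr G) (a : R (arr_r x)) (b : R (arr_r y)) :
  arr_s x <> arr_r y -> cp_mul (single a) (single b) = 0.
Proof.
move=> xy; apply: finSectionP => z; apply: fsbig1 => p _.
apply: contrapT => /cp_term_neq0 [n1 n2]; apply: xy.
have -> : x = Arr (flft p).
  by apply: contrapT => n; apply: n1; apply: single_neq.
have -> : y = Arr (frgt p).
  by apply: contrapT => n; apply: n2; apply: single_neq.
by [].
Qed.

Fact cp_mulA : associative cp_mul.
Proof.
have [[_ _] _ tw co] := fsP F.
move=> f g h.
elim/finSection_ind: f => [|x a f IHf]; first by rewrite !cp_mul0l.
rewrite !cp_mulDl {}IHf; congr (_ + _).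
elim/finSection_ind: g => [|y b g IHg].
  by rewrite !(cp_mul0l, cp_mul0r).
rewrite !(cp_mulDl, cp_mulDr) {}IHg; congr (_ + _).
elim/finSection_ind: h => [|z c h IHh]; first by rewrite !cp_mul0r.
rewrite !cp_mulDr {}IHh; congr (_ + _).
have [xy|xy] := pselect (arr_s x = arr_r y); last first.
  rewrite (cp_mul_single0 a b xy) cp_mul0l.
  have [yz|yz] := pselect (arr_s y = arr_r z); last first.
    by rewrite (cp_mul_single0 b c yz) cp_mul0r.
  case: x y z a b c xy yz => [t u x] [u' v y] [v' w z] /= a b c xy yz; subst v'.
  by rewrite (cp_mul_single y z b c) cp_mul_single0.
have [yz|yz] := pselect (arr_s y = arr_r z); last first.
  rewrite (cp_mul_single0 b c yz) cp_mul0r.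
  case: x y z a b c xy yz => [t u x] [u' v y] [v' w z] /= a b c xy yz; subst u'.
  by rewrite (cp_mul_single x y a b) cp_mul_single0.
case: x y z a b c xy yz => [t u x] [u' v y] [v' w z] /= a b c xy yz.
subst u' v'.
rewrite (cp_mul_single y z b c) (cp_mul_single x y a b).
rewrite (cp_mul_single x (gcomp y z)) (cp_mul_single (gcomp x y) z).
rewrite gcompA; congr single.
rewrite !rmorphM tw !mulrA -!(mulrA (a * _)).
congr (_ * _).
have /(congr1 (@uval _)) /= e := co _ _ _ _ x y z.
by rewrite -!mulrA -e (mulrA (uinv _)) uVval mul1r.
Qed.

Definition cp_assocRing : assocRing := AssocRing cp_mulA cp_mulDl cp_mulDr.

Definition cp_comp (x : arr G) : set cp_assocRing :=
  [set f : finSection | forall y, y <> x -> f y = 0].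

Lemma cp_comp_single x (a : R (arr_r x)) : cp_comp x (single a).
Proof. by move=> y yx; apply: single_neq => e; apply: yx. Qed.

Lemma cp_compE x (f : cp_assocRing) :
  cp_comp x f -> exists a : R (arr_r x), f = single a.
Proof. by move=> fx; exists ((f : finSection) x); apply: single_at. Qed.

Fact cp_comp0 x : cp_comp x 0. Proof. by []. Qed.

Fact cp_compB x a b : cp_comp x a -> cp_comp x b -> cp_comp x (a - b).
Proof.
move=> ax bx y yx.
by rewrite (secBE (a : finSection) (b : finSection)) ax // bx // subr0.
Qed.

Lemma sec_sumE (c : arr G -> finSection) (y : arr G) :
  finite_set [set x | c x <> 0] ->
  (\sum_(x \in [set: arr G]) c x : finSection) y
  = \sum_(x \in [set: arr G]) c x y.
Proof.
move=> /finite_fsetP [X EX].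
have cX x : x \notin X -> c x = 0.
  by move=> nx; apply: contrapT => cx; move/negP: nx; apply;
     have : [set` X] x by rewrite -EX.
rewrite (fsbigTE X) // [RHS](fsbigTE X); last by move=> x /cX ->.
exact: (big_morph (fun f : finSection => f y) (fun f g => secDE f g y) (sec0E y)).
Qed.

Fact cp_direct (f : cp_assocRing) : exists! c : arr G -> cp_assocRing,
  [/\ forall x, cp_comp x (c x), finite_set [set x | c x <> 0]
    & f = \sum_(x \in [set: arr G]) c x].
Proof.
have diag (c : arr G -> finSection) (y : arr G) :
    (forall x, cp_comp x (c x)) -> finite_set [set x | c x <> 0] ->
    (\sum_(x \in [set: arr G]) c x : finSection) y = c y y.
  move=> cx cf; rewrite sec_sumE // -(fsbig_widen [set y]) ?fsbig_set1 //.
  by move=> x /= [_ xy]; apply: cx => e; apply: xy.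
exists (fun x => single ((f : finSection) x)); split.
  have ff : finite_set [set x | single ((f : finSection) x) <> 0].
    apply: (sub_finite_set _ (sec_fin f)) => x /= n0 e; apply: n0.
    by rewrite e single0.
  split=> //; first by move=> x; exact: cp_comp_single.
  apply: finSectionP => y; rewrite diag // ?singleE //.
  by move=> x; exact: cp_comp_single.
move=> c [cx cf ->]; apply: functional_extensionality_dep => x.
rewrite (diag c x cx cf); apply/esym/single_at; exact: cx.
Qed.

Fact cp_mul_comp (u v w : G) (x : hom u v) (y : hom v w) (a b : cp_assocRing) :
  cp_comp (Arr x) a -> cp_comp (Arr y) b ->
  cp_comp (Arr (gcomp x y)) (ar_mul a b).
Proof.
move=> /cp_compE [a' ->] /cp_compE [b' ->] /=.
rewrite (cp_mul_single x y a' b'); exact: cp_comp_single.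
Qed.

Fact cp_mul_zero (x y : arr G) (a b : cp_assocRing) : arr_s x <> arr_r y ->
  cp_comp x a -> cp_comp y b -> ar_mul a b = 0.
Proof.
move=> xy /cp_compE [a' ->] /cp_compE [b' ->]; exact: cp_mul_single0.
Qed.

Definition cp_gradedRing : gradedRing G :=
  GradedRing cp_comp0 cp_compB cp_direct cp_mul_comp cp_mul_zero.

Definition cp_unit_emb (u : G) (a : R u) : cp_gradedRing :=
  single (a : R (arr_r (Arr (gid u)))).

Fact cp_cross_unital :
  @object_unital G cp_gradedRing (fun u => cp_unit_emb (1 : R u)).
Proof.
have [[_ M1] C2F _ _] := fsP F.
split=> [u|x a /cp_compE [a' ->]]; first exact: cp_comp_single.
case: x a' => u v x a' /=; split.
  rewrite (cp_mul_single (gid u) x) gcomp1l; congr single.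
  by rewrite M1 mul1r (C2F _ _ x).2 /= mulr1.
rewrite (cp_mul_single x (gid v)) gcomp1r; congr single.
by rewrite rmorph1 mulr1 (C2F _ _ x).1 /= mulr1.
Qed.

Fact cp_cross_inv (u v : G) (x : hom u v) : exists a b : cp_gradedRing,
  [/\ gr_comp (Arr x) a, gr_comp (Arr (ginv x)) b,
      ar_mul b a = cp_unit_emb (1 : R v) & ar_mul a b = cp_unit_emb (1 : R u)].
Proof.
have [[_ M1] C2F _ co] := fsP F.
pose c : units (R v) := ((fs_tau F (ginv x) x)^-1)%g.
exists (single (1 : R (arr_r (Arr x)))), (single (uval c : R (arr_r (Arr (ginv x))))).
split; try exact: cp_comp_single; rewrite [LHS]/=.
  rewrite (cp_mul_single (ginv x) x) gcompVl; congr single.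
  by rewrite rmorph1 mulr1 /= uVval.
rewrite (cp_mul_single x (ginv x)) gcompVr; congr single.
have := co _ _ _ _ x (ginv x) x.
rewrite gcompVl gcompVr (C2F _ _ x).1 (C2F _ _ x).2 !mulg1 => ->.
by rewrite mul1r /= -rmorphM uVval rmorph1.
Qed.

Fact cp_unit_embD u : {morph @cp_unit_emb u : a b / a + b}.
Proof. by move=> a b; exact: singleD. Qed.

Fact cp_unit_embM u : {morph @cp_unit_emb u : a b / a * b >-> ar_mul a b}.
Proof.
have [[_ M1] C2F _ _] := fsP F.
move=> a b /=; rewrite (cp_mul_single (gid u) (gid u)) gcomp1l.
by rewrite M1 (C2F _ _ (gid u)).1 /= mulr1.
Qed.

Fact cp_unit_emb_inj u : injective (@cp_unit_emb u).
Proof.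
move=> a b /(congr1 (fun f : finSection => f (Arr (gid u)))).
by rewrite !singleE.
Qed.

Fact cp_unit_emb_range u :
  range (@cp_unit_emb u) = gr_comp (g := cp_gradedRing) (Arr (gid u)).
Proof.
apply/seteqP; split=> [f [a _ <-]|f /cp_compE [a ->]].
  exact: cp_comp_single.
by exists a.
Qed.

Definition cross : crossedProduct R :=
  CrossedProduct cp_cross_unital cp_cross_inv cp_unit_embD cp_unit_embM
    cp_unit_emb_inj cp_unit_emb_range.

End CrossedProductOfFactorSystem.

Definition ExtM (G : groupoid) (R : ringBundle G) (M : morFamily R)
    (C : crossedProduct R -> Prop) : Prop :=
  Ext C /\ exists F : factorSystem R, mor_sim M (fs_mor F) /\ C (cross F).

(* Main.v *)
From mathcomp Require Import all_boot all_algebra.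
From mathcomp Require Import boolp classical_sets cardinality fsbigop.
Require Import Defs.

Set Implicit Arguments.
Unset Strict Implicit.
Unset Printing Implicit Defensive.
Import GRing.Theory.
Local Open Scope classical_set_scope.
Local Open Scope ring_scope.

(** Everything rests on the gauge action of the cochains h : x |-> h(x) on
    factor systems.  In a crossed product with distinguished basis v_x, where
    v_x v_y = tau(x,y) v_xy and v_x b = M_x(b) v_x, the system h.(M,tau) is the
    one read off from the basis h(x) v_x.  So h.(M,tau) is again a factor system
    ([is_factor_system_act]), and the change of basis
    f(x) v_x = (f(x) h(x)^-1) (h(x) v_x) is an equivalence of crossed products
    ([fs_sim_cp_equiv]).

    For (a), a class in Ext_[M] contains the crossed product of some (h.M, tau'),
    and the basis change by h^-1 brings it to the form (M, h^-1.tau').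

    For (b), let (M,tau) and (M,tau') be factor systems.  Both tau(x,y) and
    tau'(x,y) conjugate M_xy into M_x M_y, and M_xy is onto, so their quotient
    rho = tau^-1 tau' is central; dividing one cocycle identity by the other
    then says that d^2 rho = 1 ([factor_system_quotient_Z2]).  A gauge
    transformation h carrying (M,tau) to (M,tau') fixes M, and by the same
    surjectivity this means that h is central ([act_mor_fix]); for central h one
    has h.tau = tau d^1 h ([act_central]), so tau' = h.tau says exactly that
    rho = d^1 h ([fs_sim_B2]).  *)

(** * Central units and unit morphisms *)

Section Units.
Variable R : pzRingType.
Implicit Types a b : units R.

Lemma units_mulKr a (n : R) : uinv a * (uval a * n) = n.
Proof. by rewrite mulrA uVval mul1r. Qed.

Lemma units_mulVKr a (n : R) : uval a * (uinv a * n) = n.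
Proof. by rewrite mulrA uvalV mul1r. Qed.

Lemma central_unitP a : central (uval a) -> central_unit a.
Proof.
move=> ca; split=> // n.
by rewrite -[LHS]mulr1 -(uvalV a) -mulrA (mulrA n) -ca !mulrA uVval mul1r.
Qed.

Lemma central_unitV a : central_unit a -> central_unit a^-1%g.
Proof. by case=> _; apply: central_unitP. Qed.

Lemma central_unitC a b : central_unit a -> (a * b = b * a)%g.
Proof. by case=> ca _; apply: units_inj; exact: ca. Qed.

(** Two units that conjugate a surjection in the same way differ by a central
    unit.  It applies to the values of tau and tau' and, with one unit equal to 1,
    to those of a cochain that fixes M.  *)
Lemma central_unit_conj (S : pzRingType) (f : S -> R) a b : bijective f ->
  (forall n, uval a * f n * uval a^-1%g = uval b * f n * uval b^-1%g) ->
  central_unit (a^-1 * b)%g.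
Proof.
case=> g _ gK ab; apply: central_unitP => n.
have := ab (g n); rewrite gK => /(congr1 (fun m => uinv a * m * uval b)) /=.
rewrite -!mulrA uVval mulr1 units_mulKr => ->.
by rewrite mulrA.
Qed.
End Units.

Section UnitMorphism.
Variables (R S : pzRingType) (f : {rmorphism R -> S}).

Lemma umap1 : umap f 1%g = 1%g.
Proof. by apply: units_inj; rewrite /= rmorph1. Qed.

Lemma umapM a b : umap f (a * b)%g = (umap f a * umap f b)%g.
Proof. by apply: units_inj; rewrite /= rmorphM. Qed.

Lemma umapV a : umap f a^-1%g = (umap f a)^-1%g.
Proof. exact: units_inj. Qed.

(** An isomorphism maps the centre into the centre; it is surjectivity of f
    that makes the image commute with everything.  *)
Lemma umap_central a : bijective f -> central_unit a -> central_unit (umap f a).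
Proof.
move=> [g _ gK] [ca _]; apply: central_unitP => n.
by rewrite -(gK n) /= -!rmorphM ca.
Qed.

Lemma umap_conj c a (g : {rmorphism R -> S}) :
  g =1 conj_mor c f -> umap g a = (c * umap f a * c^-1)%g.
Proof. by move=> e; apply: units_inj; rewrite /= e. Qed.

Lemma conj_mor_bij c : bijective f -> bijective (conj_mor c f).
Proof.
case=> g fK gK; exists (fun n => g (uinv c * n * uval c)) => n.
  by rewrite /conj_mor /= -!mulrA uVval mulr1 units_mulKr fK.
by rewrite /conj_mor /= gK -!mulrA uvalV mulr1 units_mulVKr.
Qed.
End UnitMorphism.

(** * The gauge action on factor systems *)

Section FactorSystems.
Variables (G : groupoid) (R : ringBundle G).
Implicit Types (M : morFamily R) (tau rho : cochain2 R) (h : cochain1 R).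

Definition cochain1_inv h : cochain1 R := fun u v x => (h u v x)^-1%g.

Lemma C1_inv h : C1 h -> C1 (cochain1_inv h).
Proof. by move=> h1 u; rewrite /cochain1_inv h1 invg1. Qed.

Lemma act_morE h M u v (x : hom u v) n :
  act_mor h M x n = uval (h _ _ x) * M _ _ x n * uinv (h _ _ x).
Proof. by []. Qed.

(** The action is that of a group, so the pointwise inverse of h undoes it.  *)
Lemma act_mor_inv h M M' :
  eq_mor M' (act_mor h M) -> eq_mor M (act_mor (cochain1_inv h) M').
Proof.
move=> e u v x n; rewrite act_morE e act_morE /=.
by rewrite -!mulrA uVval mulr1 units_mulKr.
Qed.

(** On units, the twisted action condition is an identity in the unit group; it
    moves tau(x,y) past M_xy(a) in the cocycle computations.  *)
Lemma twisted_action_umap M tau (M_tau : twisted_action M tau)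
    u v w (x : hom u v) (y : hom v w) (a : units (R w)) :
  (umap (M _ _ x) (umap (M _ _ y) a) * tau _ _ _ x y
   = tau _ _ _ x y * umap (M _ _ (gcomp x y)) a)%g.
Proof. by apply: units_inj; rewrite /= M_tau /= -!mulrA uVval mulr1. Qed.

Lemma C1_Iso_act h M M' :
  C1 h -> eq_mor M' (act_mor h M) -> C1_Iso M -> C1_Iso M'.
Proof.
move=> h1 e [Mbij M1]; split=> [u v x|u n].
  exact: eq_bij (conj_mor_bij (h _ _ x) (Mbij _ _ x)) _ (fsym (e _ _ x)).
by rewrite e act_morE h1 M1 /= mul1r mulr1.
Qed.

(** Products of the elements h(x) v_x are computed in the crossed product of
    (M,tau), and their structure constants are h.tau.  In the cocycle identity
    both sides reduce to h(x) M_x(h(y)) M_x(M_y(h(z))) times the corresponding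
    side of the identity for tau, times h(xyz)^-1.  The family M' is only
    required to agree pointwise with h.M, so that the result applies to a given
    M and not just to the chosen representation of its conjugates.  *)
Lemma is_factor_system_act h M M' tau :
  C1 h -> eq_mor M' (act_mor h M) -> is_factor_system M tau ->
  is_factor_system M' (act_cochain2 h M tau).
Proof.
move=> h1 e [Miso tau1 M_tau co]; split; first exact: C1_Iso_act e Miso.
- have [_ M1] := Miso; move=> u v x; rewrite /act_cochain2 gcomp1l gcomp1r.
  rewrite !h1 umap1 (tau1 _ _ x).1 (tau1 _ _ x).2 !mulg1 mul1g mulgV.
  split=> //; rewrite (_ : umap _ _ = h u v x) ?mulgV //.
  by apply: units_inj; rewrite /= M1.
- move=> u v w x y n; rewrite !(e, act_morE) /=.
  by rewrite !rmorphM M_tau /= -!mulrA !units_mulKr.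
- move=> t u v w x y z; rewrite (umap_conj _ (e _ _ x)) /act_cochain2 !umapM umapV.
  rewrite -!mulgA !mulKg -gcompA; congr (_ * (_ * _))%g.
  (* M_x(M_y(h(z))) tau(x,y) replaces tau(x,y) M_xy(h(z)), which brings
     tau(x,y) next to tau(xy,z). *)
  rewrite gcompA 2!mulgA -(twisted_action_umap M_tau) -!mulgA; congr (_ * _)%g.
  by rewrite !mulgA co.
Qed.

Lemma cochain2P tau tau' :
  (forall u v w (x : hom u v) (y : hom v w), tau _ _ _ x y = tau' _ _ _ x y) ->
  tau = tau'.
Proof. by move=> e; do 5 apply: functional_extensionality_dep => ?; exact: e. Qed.

Lemma fs_sim_sym (F F' : factorSystem R) : fs_sim F F' -> fs_sim F' F.
Proof.
case=> h [h1 eM etau]; exists (cochain1_inv h).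
split; [exact: C1_inv | exact: act_mor_inv | apply: cochain2P => u v w x y].
rewrite etau /act_cochain2 /cochain1_inv (umap_conj _ (eM _ _ x)) umapV.
by rewrite invgK !mulgA !(mulVg, mul1g, mulgVK).
Qed.

(** * Factor systems with the same M *)

(** The stabilizer of M in the gauge group is the group of central cochains:
    conjugation by h(x) is trivial on the image of M_x, which is the whole
    ring.  *)
Lemma act_mor_fix h M : C1_Iso M -> C1 h -> eq_mor M (act_mor h M) <-> CZ1 h.
Proof.
case=> Mbij _ h1; split=> [e|[_ hZ] u v x n].
  split=> // u v x; rewrite -[h u v x]mul1g -invg1.
  apply: (central_unit_conj (Mbij _ _ x)) => n.
  by rewrite invg1 /= mul1r mulr1 {1}e.
by rewrite act_morE (hZ _ _ x).1 -mulrA uvalV mulr1.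
Qed.

(** When h is central, so is M_x(h(y)), and the three factors of h.tau other
    than tau(x,y) can be collected into the coboundary of h.  *)
Lemma act_central h M tau : C1_Iso M -> CZ1 h ->
  act_cochain2 h M tau = cochain2_mul tau (d1 M h).
Proof.
case=> Mbij _ [_ hZ]; apply: cochain2P => u v w x y.
have hxC := central_unitC _ (hZ _ _ x).
have MyC := central_unitC _ (umap_central (Mbij _ _ x) (hZ _ _ y)).
rewrite /act_cochain2 /cochain2_mul /d1.
by rewrite -!mulgA hxC -!mulgA MyC -!mulgA MyC !mulgA.
Qed.

(** The twisted action condition makes rho = tau^-1 tau' central; cancelling the
    cocycle identity of tau from that of tau' = tau rho leaves the one of rho.  *)
Lemma factor_system_quotient_Z2 M tau tau' :
  is_factor_system M tau -> is_factor_system M tau' ->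
  Z2 M (cochain2_mul (cochain2_inv tau) tau').
Proof.
move=> [[Mbij _] tau1 M_tau co] [_ tau'1 M_tau' co'].
set rho := cochain2_mul _ _.
have rhoZ u v w (x : hom u v) (y : hom v w) : central_unit (rho _ _ _ x y).
  by apply: (central_unit_conj (Mbij _ _ (gcomp x y))) => n; rewrite -M_tau -M_tau'.
have tauE u v w (x : hom u v) (y : hom v w) :
    tau' _ _ _ x y = (tau _ _ _ x y * rho _ _ _ x y)%g by rewrite mulVKg.
have rho1 : C2 rho.
  move=> u v x; rewrite /rho /cochain2_mul /cochain2_inv.
  by have [-> ->] := tau1 _ _ x; have [-> ->] := tau'1 _ _ x; rewrite mulVg.
(* With rho opaque, reassociating products does not open it up. *)
clearbody rho; split=> // t u v w x y z.
have rho_co : (rho _ _ _ x y * rho _ _ _ (gcomp x y) z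
    = umap (M _ _ x) (rho _ _ _ y z) * rho _ _ _ x (gcomp y z))%g.
  apply: (mulgI (tau _ _ _ x y * tau _ _ _ (gcomp x y) z)%g).
  have MrhoC := central_unitC _ (umap_central (Mbij _ _ x) (rhoZ _ _ _ y z)).
  have := co' _ _ _ _ x y z; rewrite !tauE umapM -!mulgA => co'E.
  rewrite (mulgA _ (rho _ _ _ x y)) -(central_unitC _ (rhoZ _ _ _ x y)).
  rewrite -mulgA co'E [RHS]mulgA co -mulgA.
  by rewrite [in LHS](mulgA (umap _ (rho _ _ _ _ _))) [in LHS]MrhoC -mulgA.
rewrite /d2 -(mulgA _ _^-1 (rho _ _ _ _ _))%g.
rewrite (central_unitC _ (central_unitV (rhoZ _ _ _ (gcomp x y) z))).
by rewrite !mulgA -rho_co mulgK mulgV.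
Qed.

(** A gauge transformation between two systems with the same M must fix M, so it
    is central and changes tau by its coboundary.  *)
Lemma fs_sim_B2 M tau tau'
    (H : is_factor_system M tau) (H' : is_factor_system M tau') :
  fs_sim (FactorSystem H) (FactorSystem H') <->
  B2 M (cochain2_mul (cochain2_inv tau) tau').
Proof.
have [Miso _ _ _] := H; split=> [[h [h1 eM /= etau]]|[h hZ eh]].
  have hZ : CZ1 h by apply/(act_mor_fix Miso h1).
  exists h => //; apply: cochain2P => u v w x y.
  by rewrite etau act_central // /cochain2_mul mulKg.
have [h1 _] := hZ; exists h; split=> //; first exact/(act_mor_fix Miso h1).
rewrite act_central //= eh; apply: cochain2P => u v w x y.
by rewrite /cochain2_mul mulVKg.
Qed.
End FactorSystems.

(** * Change of basis in crossed products *)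

Section Sections.
Variables (G : groupoid) (R : ringBundle G).
Implicit Types (c : forall x : arr G, units (R (arr_r x))) (f g : finSection R).

Fact sec_mulr_fin c f : finite_set [set x | f x * uval (c x) <> 0].
Proof.
by apply: (sub_finite_set _ (sec_fin f)) => x /= + e; apply; rewrite e mul0r.
Qed.

Definition sec_mulr c f := FinSection (sec_mulr_fin c f).

Lemma sec_mulrD c : {morph sec_mulr c : f g / f + g}.
Proof. by move=> f g; apply: finSectionP => x /=; rewrite mulrDl. Qed.

Lemma sec_mulr0 c : sec_mulr c 0 = 0.
Proof. by apply: finSectionP => x /=; rewrite mul0r. Qed.

Lemma sec_mulr_single c x (a : R (arr_r x)) :
  sec_mulr c (single a) = single (a * uval (c x)).
Proof.
rewrite [LHS](@single_at _ _ x) /= ?sec_singleE // => y yx.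
by rewrite sec_single_neq ?mul0r // => e; apply: yx.
Qed.

Lemma sec_mulrK c c' : (forall x, (c x * c' x = 1)%g) ->
  cancel (sec_mulr c) (sec_mulr c').
Proof.
move=> cc' f; apply: finSectionP => x /=; rewrite -mulrA.
by have /= -> := congr1 (@uval _) (cc' x); rewrite mulr1.
Qed.
End Sections.

Section Equivalence.
Variables (G : groupoid) (R : ringBundle G).

Lemma cp_equiv_trans (S T U : crossedProduct R) :
  cp_equiv S T -> cp_equiv T U -> cp_equiv S U.
Proof.
move=> [f [fbij [fD fM] fgr femb]] [g [gbij [gD gM] ggr gemb]].
exists (g \o f); split; first exact: bij_comp.
- by split=> a b /=; rewrite (fD, fM) (gD, gM).
- by move=> x; rewrite -image_comp fgr ggr.
- by move=> u a; rewrite /= femb gemb.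
Qed.

(** With v_x the distinguished basis of the first crossed product, h(x) v_x plays
    the role of the basis of the second, so f(x) v_x has coordinate f(x) h(x)^-1
    there.  Both sides of the multiplicativity condition are biadditive, so homogeneous
    elements suffice; the normalization h(u) = 1 makes the map the identity
    on R.  *)
Lemma fs_sim_cp_equiv (F F' : factorSystem R) :
  fs_sim F F' -> cp_equiv (cross F) (cross F').
Proof.
case=> h [h1 eM etau].
pose c (x : arr G) := h _ _ (arr_hom x).
pose phi := sec_mulr (fun x => (c x)^-1)%g.
pose psi := sec_mulr c.
have phiK : cancel phi psi by apply: sec_mulrK => x; rewrite mulVg.
have psiK : cancel psi phi by apply: sec_mulrK => x; rewrite mulgV.
exists phi; split.
- by exists psi.
- split; first exact: sec_mulrD.
  rewrite /phi => f g /=.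
  elim/finSection_ind: f => [|x a f IHf].
    by rewrite !(cp_mul0l, sec_mulr0).
  rewrite !(cp_mulDl, sec_mulrD) {}IHf; congr (_ + _).
  elim/finSection_ind: g => [|y b g IHg].
    by rewrite !(cp_mul0r, sec_mulr0).
  rewrite !(cp_mulDr, sec_mulrD) {}IHg; congr (_ + _).
  rewrite !sec_mulr_single.
  have [xy|xy] := pselect (arr_s x = arr_r y); last first.
    by rewrite !cp_mul_single0 ?sec_mulr0.
  case: x y a b xy => [u v x] [v' w y] /= a b xy; subst v'.
  rewrite (cp_mul_single F x y) (cp_mul_single F' x y) sec_mulr_single.
  congr single; rewrite eM act_morE etau /c /= rmorphM -!mulrA !units_mulKr.
  by rewrite (mulrA (fs_mor F x (uinv _))) -rmorphM uVval rmorph1 mul1r.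
- move=> x; apply/seteqP; split=> [_ [f fx <-] y|f fx].
    by move=> /fx /= ->; rewrite mul0r.
  exists (psi f) => // y /fx /= ->; exact: mul0r.
- move=> u a; rewrite /= /phi sec_mulr_single; congr single.
  by rewrite /c h1 /= mulr1.
Qed.
End Equivalence.

Theorem theorem5p5 (G : groupoid) (R : ringBundle G) (M : morFamily R)
    (outerM : outer M)
    (ExtM_nonempty : exists C : crossedProduct R -> Prop, ExtM M C) :
  (forall C : crossedProduct R -> Prop, ExtM M C ->
     exists (tau : cochain2 R) (H : is_factor_system M tau),
       C (cross (FactorSystem H)))
  /\
  (forall (tau' tau : cochain2 R)
     (H' : is_factor_system M tau') (H : is_factor_system M tau),
     Z2 M (cochain2_mul (cochain2_inv tau) tau')
     /\
     (fs_sim (FactorSystem H') (FactorSystem H) <->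
      B2 M (cochain2_mul (cochain2_inv tau) tau'))).
Proof.
split=> [C [[S ->] [F [[h [h1 eM]] S_F]]]|tau' tau H' H].
  have hV1 := C1_inv h1; have eMV := act_mor_inv eM.
  have H := is_factor_system_act hV1 eMV (fsP F).
  exists (act_cochain2 (cochain1_inv h) (fs_mor F) (fs_tau F)), H.
  apply: cp_equiv_trans S_F (fs_sim_cp_equiv _).
  by exists (cochain1_inv h).
split; first exact: factor_system_quotient_Z2.
by rewrite -fs_sim_B2; split; exact: fs_sim_sym.
Qed.
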